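(* Let $X$ be a Hausdorff topological space, $W$ a real Banach space with a continuous inclusion $X\subset W'$, and $F:X\to W'$ a Borel map. Suppose $K$ is a compact and metrizable subset of $X$ and $F$ is continuous on $K$. Assume the set $\mathcal{P}_{\mathrm{wsss}}(K)$ of weak stationary statistical solutions (of $du/dt=F(u)$) carried by $K$ is not empty. Let $\phi\in\mathcal{C}(K)$. Then $$\max_{\mu\in\mathcal{P}_{\mathrm{wsss}}(K)} \int_K \phi(u)\,d\mu(u) = \inf_{\Psi\in\mathcal{T}^{\mathrm{cyl}}(W')}\ \max_{u\in K}\left\{\phi(u)+\langle F(u),\Psi'(u)\rangle_{W',W}\right\}.$$
   Context: $W'$ is the dual of $W$ with the dual norm, and $\langle\cdot,\cdot\rangle_{W',W}$ is the duality product. $\mathcal{C}(K)$ is the space of continuous real-valued functions on $K$. Cylindrical test functionals: $\mathcal{T}^{\mathrm{cyl}}(W')$ is the set of functions $\Psi:W'\to\mathbb{R}$ of the form $\Psi(u)=\psi(\langle u,w_1\rangle_{W',W},\ldots,\langle u,w_m\rangle_{W',W})$, with $m\in\mathbb{N}$, $w_1,\ldots,w_m\in W$ and $\psi\in\mathcal{C}^1_c(\mathbb{R}^m)$ (compactly supported, continuously differentiable, real-valued). Its derivative is $\Psi'(u)=\sum_{j=1}^m\partial_j\psi(\langle u,w_1\rangle_{W',W},\ldots,\langle u,w_m\rangle_{W',W})\,w_j\in W$. Weak stationary statistical solution of $du/dt=F(u)$: a Borel probability measure $\mu$ on $X$ such that, for every $\Psi\in\mathcal{T}^{\mathrm{cyl}}(W')$,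 the map $u\mapsto\langle F(u),\Psi'(u)\rangle_{W',W}$ is $\mu$-integrable and $\int_X\langle F(v),\Psi'(v)\rangle_{W',W}\,d\mu(v)=0$. For a Borel set $E\subset X$, $\mathcal{P}_{\mathrm{wsss}}(E)$ is the set of all weak stationary statistical solutions carried by $E$, i.e. with $\mu(X\setminus E)=0$. *)

(* Defs.v *)
From HB Require Import structures.
From mathcomp Require Import all_boot all_order all_algebra.
From mathcomp Require Import all_classical all_reals all_analysis.

Set Implicit Arguments.
Unset Strict Implicit.
Unset Printing Implicit Defensive.
Import Order.TTheory GRing.Theory Num.Theory.
Import numFieldNormedType.Exports.
Local Open Scope classical_set_scope.
Local Open Scope ring_scope.

Section Dual.
Context {R : realType} (W : normedModType R).

Definition dual_pred : {pred W -> R} :=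
  fun f => `[< linear f /\ continuous f >].

(* The dual W' of all continuous linear forms; the instances below make it a
   normed space for the dual (operator) norm. *)
Record dual := Dual {
  dual_fun :> W -> R ;
  dual_funP : dual_fun \in dual_pred }.

HB.instance Definition _ := [isSub for dual_fun].
HB.instance Definition _ := [Choice of dual by <:].

Lemma dual_pred_submod_closed : submod_closed dual_pred.
Proof.
split=> [|a f g /asboolP[lf cf] /asboolP[lg cg]]; apply/asboolP; split.
- by move=> k u v /=; rewrite scaler0 addr0.
- by move=> x; exact: cvg_cst.
- move=> k u v; rewrite !fctE lf lg scalerDr [in RHS]scalerDr !scalerA.
  by rewrite (mulrC k a) addrACA.
- move=> x; apply: (@cvgD _ R^o); last exact: cg.
  by apply: (@cvgZl_tmp _ R^o); exact: cf.
Qed.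

HB.instance Definition _ :=
  GRing.isSubmodClosed.Build R (W -> R) dual_pred dual_pred_submod_closed.
HB.instance Definition _ := [SubChoice_isSubLmodule of dual by <:].

Lemma dual_linear (f : dual) : linear (f : W -> R).
Proof. by case: f => f /= /asboolP[]. Qed.

HB.instance Definition _ (f : dual) :=
  GRing.isLinear.Build R W R *:%R (f : W -> R) (@dual_linear f).

Lemma dual_continuous (f : dual) : continuous (f : W -> R).
Proof. by case: f => f /= /asboolP[]. Qed.

Lemma dualD (f g : dual) w : (f + g) w = f w + g w.
Proof. by []. Qed.

Lemma dualZ (a : R) (f : dual) w : (a *: f) w = a * f w.
Proof. by []. Qed.

Definition dual_norm (f : dual) : R :=
  sup [set `|f w| | w in [set w : W | `|w| <= 1]].

Let norm_set_neq0 (f : dual) : [set `|f w| | w in [set w : W | `|w| <= 1]] !=set0.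
Proof. by exists `|f 0|, 0 => //=; rewrite normr0. Qed.

Lemma le_dual_norm1 (f : dual) w : `|w| <= 1 -> `|f w| <= dual_norm f.
Proof.
move=> w1; apply: ub_le_sup; last by exists w.
have /linear_boundedP : bounded_near (f : W -> R) (nbhs (0 : W)).
  by apply: continuous_linear_bounded => /=; exact: dual_continuous.
move=> /pinfty_ex_gt0[M M0 fM]; exists M => _ [v /= v1 <-].
by rewrite (le_trans (fM v))// ler_piMr// ltW.
Qed.

Lemma dual_norm_le (f : dual) M :
  (forall w : W, `|w| <= 1 -> `|f w| <= M) -> dual_norm f <= M.
Proof. by move=> fM; apply: ge_sup => // _ [w /= w1 <-]; exact: fM. Qed.

Lemma ler_dual_norm (f : dual) w : `|f w| <= dual_norm f * `|w|.
Proof.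
have [->|w0] := eqVneq w 0; first by rewrite linear0 !normr0 mulr0.
rewrite -ler_pdivrMr ?normr_gt0// -[X in _ / X]normr_id -normf_div.
have -> : f w / `|w| = f (`|w|^-1 *: w) by rewrite linearZ /= mulrC.
by apply: le_dual_norm1; rewrite normrZ normfV normr_id mulVf// normr_eq0.
Qed.

Let dual_ler_normD (f g : dual) : dual_norm (f + g) <= dual_norm f + dual_norm g.
Proof.
apply: dual_norm_le => w w1; rewrite dualD (le_trans (ler_normD _ _))//.
by rewrite lerD// le_dual_norm1.
Qed.

Let dual_normZ_le (a : R) (f : dual) : dual_norm (a *: f) <= `|a| * dual_norm f.
Proof.
apply: dual_norm_le => w w1.
by rewrite dualZ normrM ler_wpM2l// le_dual_norm1.
Qed.

Let dual_normrZ (a : R) (f : dual) : dual_norm (a *: f) = `|a| * dual_norm f.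
Proof.
apply/eqP; rewrite eq_le dual_normZ_le /=.
have [->|a0] := eqVneq a 0.
  rewrite normr0 mul0r; apply: le_trans (le_dual_norm1 _ (w := 0) _) => //.
  by rewrite normr0.
rewrite -ler_pdivlMl ?normr_gt0// -normfV.
by rewrite -{1}[f](scalerK a0) dual_normZ_le.
Qed.

Let dual_normr0_eq0 (f : dual) : dual_norm f = 0 -> f = 0.
Proof.
move=> f0; apply/val_inj/funext => w /=; apply/eqP.
by rewrite -normr_le0 (le_trans (ler_dual_norm f w))// f0 mul0r.
Qed.

HB.instance Definition _ := Lmodule_isNormed.Build R dual
  dual_ler_normD dual_normrZ dual_normr0_eq0.

Lemma dual_normE (f : dual) : `|f| = dual_norm f.
Proof. by []. Qed.

End Dual.

Definition pairing {R : realType} {W : normedModType R} (f : dual W) (w : W) : R :=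
  f w.

Definition partial {R : realType} m (psi : 'rV[R]_m -> R) (j : 'I_m) :
  'rV[R]_m -> R := 'D_(delta_mx 0 j) psi.

Definition C1c {R : realType} m (psi : 'rV[R]_m -> R) : Prop :=
  [/\ forall x, differentiable psi x,
      forall j, continuous (partial psi j)
    & compact (closure [set x | psi x != 0])].

(* A cylindrical functional is carried together with a representation
   psi(<u, w_1>, .., <u, w_m>); see [cyl_deriv_unique]. *)
Record cyl_test {R : realType} (W : normedModType R) := CylTest {
  cyl_dim : nat ;
  cyl_vec : 'I_cyl_dim -> W ;
  cyl_psi : 'rV[R]_cyl_dim -> R ;
  cyl_psi_C1c : C1c cyl_psi }.
Arguments cyl_dim {R W} Psi : rename.
Arguments cyl_vec {R W} Psi j : rename.
Arguments cyl_psi {R W} Psi x : rename.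
Arguments cyl_psi_C1c {R W} Psi : rename.

Section CylindricalTest.
Context {R : realType} {W : normedModType R}.
Implicit Types Phi Psi : cyl_test W.

Definition cyl_coord Psi (u : dual W) : 'rV[R]_(cyl_dim Psi) :=
  \row_j pairing u (cyl_vec Psi j).

Definition cyl_fun Psi (u : dual W) : R :=
  cyl_psi Psi (cyl_coord Psi u).

Definition cyl_deriv Psi (u : dual W) : W :=
  \sum_j partial (cyl_psi Psi) j (cyl_coord Psi u) *: cyl_vec Psi j.

(* [cyl_deriv] is given by a formula in the representation (m, w_j, psi); this
   lemma shows that it is the derivative of the functional itself, so that the
   values <v, Psi'(u)> depend only on the function [cyl_fun Psi]. *)
Lemma derive_cyl_fun Psi (u v : dual W) :
  'D_v (cyl_fun Psi) u = pairing v (cyl_deriv Psi u).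
Proof.
have [dpsi _ _] := cyl_psi_C1c Psi.
transitivity ('D_(cyl_coord Psi v) (cyl_psi Psi) (cyl_coord Psi u)).
  rewrite /derive; set f := (X in X @ _); set g := (X in _ = lim (X @ _)).
  suff -> : f = g by [].
  apply/funext => h; rewrite /f /g /= /cyl_fun.
  congr (_ *: (cyl_psi Psi _ - _)).
  by apply/rowP => j; rewrite !mxE.
rewrite deriveE// [X in 'd _ _ X]row_sum_delta linear_sum /=.
rewrite /pairing /cyl_deriv linear_sum /=; apply: eq_bigr => j _.
by rewrite !linearZ /= !mxE /partial deriveE//; exact: mulrC.
Qed.

Lemma cyl_deriv_unique Phi Psi : cyl_fun Phi = cyl_fun Psi ->
  forall u v, pairing v (cyl_deriv Phi u) = pairing v (cyl_deriv Psi u).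
Proof. by move=> eqf u v; rewrite -!derive_cyl_fun eqf. Qed.

End CylindricalTest.

Notation borel T := (g_sigma_algebraType (@open T)).

Section StationaryStatisticalSolution.
Context {R : realType} {X : ptopologicalType} {W : normedModType R}.
(* [incl] is the inclusion X -> W'. *)
Variables (incl F : X -> dual W).

Definition weak_sss (mu : probability (borel X) R) : Prop :=
  forall Psi : cyl_test W,
    let g := fun u : borel X => pairing (F u) (cyl_deriv Psi (incl u)) in
    mu.-integrable setT (EFin \o g) /\ \int[mu]_(u in setT) g u = 0.

Definition Pwsss (E : set X) : set (probability (borel X) R) :=
  [set mu | weak_sss mu /\ mu (~` E) = 0%E].

End StationaryStatisticalSolution.

Definition metrizable (R : realType) (T : topologicalType) : Prop :=
  exists d : T -> T -> R,
    [/\ forall x y, 0 <= d x y,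
        forall x y, d x y = 0 <-> x = y,
        forall x y, d x y = d y x,
        forall x y z, d x z <= d x y + d y z
      & forall x (U : set T), nbhs x U <->
          exists2 e : R, 0 < e & [set y | d x y < e] `<=` U].

Definition has_max {R : realType} (A : set R) : Prop := exists2 m, A m & ubound A m.

(* Main.v *)
Require Import Defs.
From HB Require Import structures.
From mathcomp Require Import all_boot all_order all_algebra.
From mathcomp Require Import all_classical all_reals all_analysis.
From mathcomp Require Import measurable_realfun lra.

Set Implicit Arguments.
Unset Strict Implicit.
Unset Printing Implicit Defensive.
Import Order.TTheory GRing.Theory Num.Theory.
Import numFieldNormedType.Exports.
Local Open Scope classical_set_scope.
Local Open Scope ring_scope.

(** Let p(f) be the infimum over Psi of the maximum over K of f + <F, Psi'>,
    for f bounded on K.  On K the functions <F, Psi'> form a vector space: a sum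
    of two cylindrical functionals becomes admissible once multiplied by a C^1
    cutoff equal to 1 near the (compact) image of K.  Hence p is sublinear, the
    given stationary solution making it finite.  By Hahn-Banach there is a linear
    l <= p with l(phi) = p(phi); it is positive, l(1) = 1, and l vanishes on all
    <F, Psi'>.  By Riesz, l is the integral against a Borel probability carried
    by K, which is therefore a stationary solution where the value p(phi) of the
    right-hand side is attained.  The other inequality is integration of
    phi <= max (phi + <F, Psi'>) - <F, Psi'>.

    The Riesz measure is the regular extension of the finitely additive set
    function A |-> l(1_A), which makes sense because l is defined on all bounded
    functions: it is the Caratheodory measure of the outer measure induced by
    the inner content U |-> sup { l(1_C) : C compact in U and K }. *)

(** * Hahn-Banach *)

(** Homogeneity is asked as an inequality only; applied to the inverse scalar it yields equality
    ([sublinearZ]). *)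
Definition sublinear {R : numDomainType} {V : lmodType R} (q : V -> R) : Prop :=
  (forall x y, q (x + y) <= q x + q y) /\
  (forall t x, 0 <= t -> q (t *: x) <= t * q x).

Section HahnBanach.
Context {R : realType} {V : lmodType R}.
Implicit Types p q : V -> R.

Lemma sublinear0 q : sublinear q -> q 0 = 0.
Proof.
move=> [qD qZ]; apply/eqP; rewrite eq_le; apply/andP; split.
  by have := qZ 0 0 (lexx _); rewrite scale0r mul0r.
by have := qD 0 0; rewrite addr0 lerDl.
Qed.

Lemma sublinearZ q t x : sublinear q -> 0 <= t -> q (t *: x) = t * q x.
Proof.
move=> sq; rewrite le_eqVlt => /predU1P[<-|t0].
  by rewrite scale0r mul0r sublinear0.
apply/eqP; rewrite eq_le sq.2 ?(ltW t0)//=.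
have tV0 : 0 <= t^-1 by rewrite invr_ge0 ltW.
have := sq.2 _ (t *: x) tV0.
by rewrite scalerA mulVf ?gt_eqF// scale1r ler_pdivlMl.
Qed.

(** Write x as (y + x) + (- y). The bound keeps every infimum below finite: those over slides and
    those over chains. *)
Lemma sublinear_geN q x y : sublinear q -> q x - q (- y) <= q (y + x).
Proof.
move=> [qD _]; rewrite lerBlDr.
by have := qD (y + x) (- y); rewrite addrAC subrr add0r.
Qed.

(* Passing from q to [slide q x] lowers q in the direction of x, unless q is
   already linear in that direction. *)
Definition slide q x y : R :=
  inf [set q (y + t *: x) - t * q x | t in [set t | 0 <= t]].

Lemma slide_has_inf q x y : sublinear q ->
  has_inf [set q (y + t *: x) - t * q x | t in [set t | 0 <= t]].
Proof.
move=> sq; split; first by exists (q (y + 0 *: x) - 0 * q x), 0 => /=.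
exists (- q (- y)) => _ [t /= t0 <-].
by have := sublinear_geN (t *: x) y sq; rewrite sublinearZ//; lra.
Qed.

Lemma slide_le q x y t : sublinear q -> 0 <= t ->
  slide q x y <= q (y + t *: x) - t * q x.
Proof. by move=> sq t0; apply: ge_inf; [exact: (slide_has_inf _ _ sq).2|exists t]. Qed.

Lemma le_slide q x y m : (forall t, 0 <= t -> m <= q (y + t *: x) - t * q x) ->
  m <= slide q x y.
Proof.
move=> h; apply: lb_le_inf; first by exists (q (y + 0 *: x) - 0 * q x), 0 => /=.
by move=> _ [t /= t0 <-]; exact: h.
Qed.

Lemma slide_sublinear q x : sublinear q -> sublinear (slide q x).
Proof.
move=> sq; split=> [y z|s y s0].
(* Parameters t for y and u for z combine into t + u for y + z. *)
- rewrite -lerBlDr; apply: le_slide => t t0.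
  rewrite lerBlDr -lerBlDl; apply: le_slide => u u0.
  rewrite lerBlDl.
  have := slide_le x (y + z) sq (addr_ge0 t0 u0).
  have := sq.1 (y + t *: x) (z + u *: x).
  by rewrite addrACA -scalerDl; lra.
(* For s > 0, the parameter t at y corresponds to s * t at s *: y. *)
- move: s0; rewrite le_eqVlt => /predU1P[<-|s0].
    rewrite scale0r mul0r (le_trans (slide_le x 0 sq (lexx 0)))//.
    by rewrite scale0r addr0 sublinear0// mul0r subrr.
  rewrite mulrC -ler_pdivrMr//; apply: le_slide => t t0.
  rewrite ler_pdivrMr//.
  have st0 : 0 <= s * t by rewrite mulr_ge0// ltW.
  have := slide_le x (s *: y) sq st0.
  by rewrite -scalerA -scalerDr (sublinearZ _ sq (ltW s0)); lra.
Qed.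

(** Zorn's lemma for the reversed pointwise order: the pointwise infimum of a nonempty chain of
    sublinear minorants of p is again one. *)
Lemma sublinear_minimal p : sublinear p ->
  exists q, [/\ sublinear q, forall x, q x <= p x &
    forall r, sublinear r -> (forall x, r x <= q x) -> forall x, q x <= r x].
Proof.
move=> sp.
pose T := {q : V -> R | sublinear q /\ forall x, q x <= p x}.
pose below (a b : T) := `[< forall x, sval b x <= sval a x >].
pose top : T := exist _ p (conj sp (fun=> lexx _)).
have [||chain|[q [sq qp]] qmin] := @ZL_preorder T top below.
- by move=> a; apply/asboolP.
- move=> a b c /asboolP ab /asboolP bc; apply/asboolP => x.
  exact: le_trans (bc x) (ab x).
- move=> tot; have [->|/set0P[a0 Aa0]] := eqVneq chain set0.
    by exists top.
  pose I x := [set sval a x | a in chain].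
  have I0 x : I x !=set0 by exists (sval a0 x), a0.
  (* From 0 = q 0 <= q x + q (- x) <= q x + p (- x), the bound - p (- x) is common to all members of
     the chain. *)
  have Ilb x : has_lbound (I x).
    exists (- p (- x)) => _ [[q [sq qp]] /= _ <-].
    have := sublinear_geN 0 x sq; rewrite sublinear0// addr0 sub0r.
    by apply: le_trans; rewrite lerN2.
  have Ile a x : chain a -> inf (I x) <= sval a x.
    by move=> Aa; apply: ge_inf => //; exists a.
  have sI : sublinear (inf \o I).
    split=> [x y|t x t0] /=.
    + rewrite -lerBlDr; apply: lb_le_inf => // _ [a Aa <-].
      rewrite lerBlDr -lerBlDl; apply: lb_le_inf => // _ [b Ab <-].
      rewrite lerBlDl.
      (* The chain is totally ordered, so the smaller of a and b serves at both points. *)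
      have [c [Ac ca cb]] : exists c, [/\ chain c, sval c x <= sval a x
          & sval c y <= sval b y].
        by have [/asboolP ab|/asboolP ba] := tot a b Aa Ab; [exists b|exists a].
      have := Ile c (x + y) Ac; have := (svalP c).1.1 x y; lra.
    + move: t0; rewrite le_eqVlt => /predU1P[<-|t0].
        rewrite scale0r mul0r (le_trans (Ile a0 0 Aa0))//.
        by rewrite sublinear0//; exact: (svalP a0).1.
      rewrite mulrC -ler_pdivrMr//; apply: lb_le_inf => // _ [a Aa <-].
      rewrite ler_pdivrMr// (le_trans (Ile a _ Aa))// mulrC.
      by apply: (svalP a).1.2; exact: ltW.
  have Ip x : inf (I x) <= p x by apply: le_trans (Ile a0 x Aa0) ((svalP a0).2 x).
  exists (exist _ (inf \o I) (conj sI Ip)) => a Aa; apply/asboolP => x /=.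
  exact: Ile.
- exists q; split=> // r sr rq x.
  have rp y : r y <= p y by exact: le_trans (rq y) (qp y).
  have /asboolP := qmin (exist _ r (conj sr rp)) (asboolT rq).
  exact.
Qed.

(** A minimal q lies below each of its slides, which are sublinear minorants of it. The parameter t
    = 1 then gives q y + q x <= q (y + x), so q is additive and hence linear. *)
Lemma sublinear_linear_minorant p : sublinear p ->
  exists l : {scalar V}, forall x, l x <= p x.
Proof.
move=> /sublinear_minimal[q [sq qp qmin]].
have qD x y : q (y + x) = q y + q x.
  apply/eqP; rewrite eq_le sq.1 /= -lerBrDr.
  have slq z : slide q x z <= q z.
    by have := slide_le x z sq (lexx 0); rewrite scale0r addr0 mul0r subr0.
  apply: le_trans (qmin _ (slide_sublinear x sq) slq y) _.
  by have := slide_le x y sq ler01; rewrite scale1r mul1r.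
have qN x : q (- x) = - q x.
  by apply/eqP; rewrite -addr_eq0 -qD addrC subrr sublinear0.
have qZ t x : q (t *: x) = t * q x.
  have [t0|/ltW t0] := leP 0 t; first exact: sublinearZ.
  by rewrite -(opprK (t *: x)) -scaleNr qN sublinearZ ?oppr_ge0// mulNr opprK.
have lin : linear_for *%R q by move=> a x y; rewrite qD qZ.
by exists (HB.pack_for {scalar V} q (GRing.isLinear.Build R V R *%R q lin)).
Qed.

(** A linear minorant of [slide p x0] is below p (parameter 0), and at - x0 it is at most p 0 - p x0
    = - p x0 (parameter 1), which forces equality at x0. *)
Lemma hahn_banach p x0 : sublinear p ->
  exists2 l : {scalar V}, forall x, l x <= p x & l x0 = p x0.
Proof.
move=> sp; have [l lp] := sublinear_linear_minorant (slide_sublinear x0 sp).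
have lp' x : l x <= p x.
  have := slide_le x0 x sp (lexx 0); rewrite scale0r addr0 mul0r subr0.
  exact: le_trans (lp x).
exists l => //; apply/eqP; rewrite eq_le lp' /= -lerN2 -linearN.
apply: le_trans (lp _) _; have := slide_le x0 (- x0) sp ler01.
by rewrite scale1r addNr mul1r sublinear0// sub0r.
Qed.

End HahnBanach.

(** * Regular extension of finitely additive set functions *)

(** Compactness, in its near-covering form, makes the member U of the filter independent of the
    point of A; the open set is then the complement of the closure of U. *)
Lemma compact_filter_separation (X : topologicalType) (A : set X)
    (G : set_system X) : ProperFilter G -> compact A ->
  (forall x, A x -> exists2 N, nbhs x N & exists2 U, G U & N `&` U = set0) ->
  exists2 V, open V /\ A `<=` V & exists2 U, G U & V `&` U = set0.
Proof.
move=> FG cA sepA.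
have : \forall U \near powerset_filter_from G, A `<=` ~` closure U.
  have FP : Filter (powerset_filter_from G) by exact: (@powerset_filter_from_filter _ G).
  apply: (iffLR (compact_near_coveringP A) cA) => x Ax.
  have [N xN [U GU NU]] := sepA x Ax.
  exists (interior N, [set W | G W /\ W `<=` U]) => /=.
    by split; [exact: nbhs_interior|exact: powerset_filter_fromP].
  case=> y W /= [Ny [_ WU]] clWy.
  have [z [Wz Nz]] := clWy _ Ny.
  by have : (N `&` U) z by [split=> //; exact: WU]; rewrite NU.
move=> /near_powerset_filter_fromP[]; last first.
  move=> U GU AU; exists (~` closure U).
    by split=> //; exact/closed_openC/closed_closure.
  exists U => //; rewrite setIC; apply/disjoints_subset; rewrite setCK.
  exact: subset_closure.
by move=> U W UW AW; apply: subset_trans AW _; apply: subsetC; exact: closureS.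
Qed.

Lemma hausdorff_compact_separation (X : topologicalType) (A B : set X) :
  hausdorff_space X -> compact A -> compact B -> A `&` B = set0 ->
  exists U V, [/\ open U, open V, A `<=` U, B `<=` V & U `&` V = set0].
Proof.
move=> hX cA cB AB.
(* For empty B the filter of neighbourhoods of B contains the empty set and is not proper. *)
have [->|/set0P B0] := eqVneq B set0.
  by exists setT, set0; split; rewrite ?setI0//; [exact: openT|exact: open0].
(* Filter separation is used twice: with the neighbourhoods of B against A, and inside, with the
   neighbourhoods of a point x of A against B. *)
have [|V [oV AV] [U sU VU]] :=
  @compact_filter_separation X A (set_nbhs B) (set_nbhs_pfilter B0) cA.
- move=> x Ax.
  have [|V [oV BV] [N xN VN]] := @compact_filter_separation X B (nbhs x) _ cB.
  + move=> y By; have := hX; rewrite open_hausdorff.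
    have yx : y != x.
      apply/eqP => yx; have : (A `&` B) x by split=> //; rewrite -yx.
      by rewrite AB.
    move=> /(_ y x yx)[[M N]/= [yM xN] [oM oN /eqP MN]].
    rewrite !inE in yM xN.
    by exists M; [exact: open_nbhs_nbhs|exists N => //; exact: open_nbhs_nbhs].
  exists N => //; exists V; last by rewrite setIC.
  by apply/set_nbhsP; exists V; split=> // ?.
- have /set_nbhsP[W [oW BW WU]] := sU; exists V, W; split=> //.
  by rewrite -subset0 -VU; exact: setIS.
Qed.

(** * From an inner content on open sets to a Borel probability *)

Section RegularExtension.
Context {R : realType} {X : ptopologicalType}.
Variables (K : set X) (m : set X -> R).
Hypotheses (hX : hausdorff_space X) (cK : compact K).
Hypothesis m_ge0 : forall A, 0 <= m A.
Hypothesis m_add : forall A B, A `&` B = set0 -> m (A `|` B) = m A + m B.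

Let m0 : m set0 = 0.
Proof.
have := @m_add set0 set0 (setI0 _); rewrite setU0 => /eqP.
by rewrite -[X in X == _]addr0 (inj_eq (addrI _)) eq_sym => /eqP.
Qed.

Let m_le A B : A `<=` B -> m A <= m B.
Proof.
move=> AB; by rewrite -(setDUK AB) m_add ?lerDl// setDIK.
Qed.

Let m_leU A B : m (A `|` B) <= m A + m B.
Proof.
rewrite -(setDUK (@subsetUl _ A B)) m_add ?setDIK// lerD2l m_le//.
by move=> x [[]].
Qed.

Definition inner_content (U : set X) : R :=
  sup [set m C | C in [set C | compact C /\ C `<=` U `&` K]].

Let inner_ub U : has_ubound [set m C | C in [set C | compact C /\ C `<=` U `&` K]].
Proof. by exists (m setT) => _ [C /= _ <-]; apply: m_le. Qed.

Let le_inner C U : compact C -> C `<=` U -> C `<=` K -> m C <= inner_content U.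
Proof.
move=> cC CU CK; apply: ub_le_sup => //; exists C => //; split=> //.
by rewrite subsetI.
Qed.

Let inner_le U M : (forall C, compact C -> C `<=` U -> C `<=` K -> m C <= M) ->
  inner_content U <= M.
Proof.
move=> h; apply: ge_sup; last first.
  by move=> _ [C /= [cC CUK] <-]; apply: h => // x /CUK[].
by exists (m set0), set0 => //=; split=> //; exact: compact0.
Qed.

Let inner_ge0 U : 0 <= inner_content U.
Proof. by rewrite -m0; apply: le_inner => //; exact: compact0. Qed.

Let inner_mono U V : U `<=` V -> inner_content U <= inner_content V.
Proof.
move=> UV; apply: inner_le => C cC CU CK; apply: le_inner => //.
exact: subset_trans UV.
Qed.

Let compactD (C U : set X) : compact C -> open U -> compact (C `\` U).
Proof.
by move=> cC oU; rewrite setDE; apply: compact_closedI => //; exact: open_closedC.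
Qed.

(** For a compact C in the union, C \ U and C \ V are disjoint compacts. Disjoint open sets G and H
    around them split C into the compacts C \ G, inside U, and C \ H, inside V. *)
Let innerU (U V : set X) : open U -> open V ->
  inner_content (U `|` V) <= inner_content U + inner_content V.
Proof.
move=> oU oV; apply: inner_le => C cC CUV CK.
have CUCV : (C `\` U) `&` (C `\` V) = set0.
  by rewrite -setDUr setD_eq0.
have [G [H [oG oH CG CH GH]]] :=
  hausdorff_compact_separation hX (compactD cC oU) (compactD cC oV) CUCV.
have CE : C = (C `\` G) `|` (C `\` H) by rewrite -setDIr GH setD0.
rewrite [in leLHS]CE (le_trans (m_leU _ _))//; apply: lerD; apply: le_inner.
- exact: compactD.
- by move=> x [Cx Gx]; apply: contrapT => Ux; apply/Gx/CG.
- by move=> x [/CK].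
- exact: compactD.
- by move=> x [Cx Hx]; apply: contrapT => Vx; apply/Hx/CH.
- by move=> x [/CK].
Qed.

Let inner0 : inner_content set0 = 0.
Proof.
apply/eqP; rewrite eq_le inner_ge0 andbT; apply: inner_le => C _ C0 _.
by rewrite -m0 m_le.
Qed.

(** Here compactness turns finite subadditivity into countable subadditivity: a compact subset of
    the union lies in finitely many of the U n. *)
Let inner_bigcup (U : (set X)^nat) : (forall n, open (U n)) ->
  ((inner_content (\bigcup_n U n))%:E <= \sum_(n <oo) (inner_content (U n))%:E)%E.
Proof.
move=> oU; set S := (X in (_ <= X)%E).
have fin_le n : (inner_content (\big[setU/set0]_(i < n) U i) <=
    \sum_(i < n) inner_content (U i)).
  elim: n => [|n ih]; first by rewrite !big_ord0 inner0.
  rewrite !big_ord_recr /= (le_trans (innerU _ _))// ?lerD2r//.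
  by apply: (big_ind open) => //; [exact: open0|move=> *; exact: openU].
suff h C : compact C -> C `<=` \bigcup_n U n -> C `<=` K -> ((m C)%:E <= S)%E.
  have [->|Sy] := eqVneq S +oo%E; first by rewrite leey.
  have S0 : (0 <= S)%E by apply: nneseries_ge0 => n _ _; rewrite lee_fin.
  have Sfin : S \is a fin_num by rewrite ge0_fin_numE// ltey.
  rewrite -(fineK Sfin) lee_fin; apply: inner_le => C cC CU CK.
  by rewrite -lee_fin (fineK Sfin) h.
move=> + CU CK => /[dup] cC; rewrite compact_cover.
move=> /(_ nat setT U (fun i _ => oU i) CU)[D _ CD].
(* One more than the largest index of the finite subcover, so that the indices below n include all
   of it. *)
pose n := (\max_(i <- finmap.enum_fset D) i).+1.
apply: (@le_trans _ _ (\sum_(i < n) inner_content (U i))%:E).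
  rewrite lee_fin (le_trans _ (fin_le n))//; apply: le_inner => // x /CD[i /= iD Uix].
  rewrite -bigcup_mkord; exists i => //=.
  by rewrite ltnS; apply: (@leq_bigmax_seq _ _ xpredT id).
rewrite -sumEFin -(big_mkord xpredT (fun i => (inner_content (U i))%:E)).
by apply: nneseries_lim_ge => i _; rewrite lee_fin.
Qed.

Definition outer_content (A : set X) : \bar R :=
  ereal_inf [set (inner_content U)%:E | U in [set U | open U /\ A `<=` U]].

Let outer_le (A U : set X) : open U -> A `<=` U ->
  (outer_content A <= (inner_content U)%:E)%E.
Proof. by move=> oU AU; apply: ereal_inf_lbound; exists U. Qed.

Let le_outer (A : set X) M :
  (forall U, open U -> A `<=` U -> (M <= (inner_content U)%:E)%E) ->
  (M <= outer_content A)%E.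
Proof. by move=> h; apply: le_ereal_inf_tmp => _ [U [oU AU] <-]; exact: h. Qed.

Let outer_ge0 A : (0 <= outer_content A)%E.
Proof. by apply: le_outer => U _ _; rewrite lee_fin. Qed.

Let outer_open (U : set X) : open U -> outer_content U = (inner_content U)%:E.
Proof.
move=> oU; apply/eqP; rewrite eq_le outer_le//=; apply: le_outer => V oV UV.
by rewrite lee_fin inner_mono.
Qed.

Let outer0 : outer_content set0 = 0%E.
Proof. by rewrite outer_open ?inner0//; exact: open0. Qed.

Let outer_mono : {homo outer_content : A B / A `<=` B >-> (A <= B)%E}.
Proof.
move=> A B AB; apply: le_outer => U oU BU; apply: outer_le => //.
exact: subset_trans BU.
Qed.

Let outer_fin A : outer_content A \is a fin_num.
Proof.
rewrite ge0_fin_numE// (le_lt_trans (outer_mono (@subsetT _ A)))//.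
by rewrite outer_open ?ltry//; exact: openT.
Qed.

Let outer_adh (A : set X) e : 0 < e -> exists U, [/\ open U, A `<=` U &
  ((inner_content U)%:E <= outer_content A + e%:E)%E].
Proof.
move=> e0; have [_ [U [oU AU] <-] h] := lb_ereal_inf_adherent e0 (outer_fin A).
by exists U; split=> //; exact: ltW.
Qed.

Let outer_sigma : sigma_subadditive outer_content.
Proof.
move=> A; apply/lee_addgt0Pr => e e0.
apply: le_trans (epsilon_trick _ _ (ltW e0)) => //.
have /choice[U hU] : forall n, exists U, [/\ open U, A n `<=` U &
    ((inner_content U)%:E <= outer_content (A n) + (e / (2 ^ n.+1)%:R)%:E)%E].
  by move=> n; apply: outer_adh; rewrite divr_gt0// ltr0n expn_gt0.
have oU n : open (U n) by have [] := hU n.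
apply: (@le_trans _ _ (inner_content (\bigcup_n U n))%:E).
  apply: outer_le; first exact: bigcup_open.
  by apply: subset_bigcup => n _; have [] := hU n.
apply: (le_trans (inner_bigcup oU)); apply: lee_nneseries => n _.
  by move=> _; rewrite lee_fin.
by have [] := hU n.
Qed.

Let outer : {outer_measure set X -> \bar R} :=
  HB.pack outer_content (isOuterMeasure.Build R X outer_content
    outer0 outer_ge0 outer_mono outer_sigma).

(** Take V open around A and C compact in V [&] U. The open set V \ C contains V \ U, and a compact
    D inside it is disjoint from C, so m C + m D is the value of m on a compact subset of V. Suprema
    over D and then C give the Caratheodory inequality. *)
Let outer_caratheodory (U : set X) : open U -> outer.-caratheodory U.
Proof.
move=> oU; apply: le_caratheodory_measurable => A /=.
apply: le_outer => V oV AV.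
apply: (@le_trans _ _ (outer_content (V `&` U) + outer_content (V `&` ~` U))%E).
  by apply: leeD; apply: outer_mono; exact: setSI.
have oVU : open (V `&` U) by exact: openI.
rewrite outer_open// -(fineK (outer_fin (V `&` ~` U))) -EFinD lee_fin -lerBrDr.
apply: inner_le => C cC CVU CK; rewrite lerBrDr -lerBrDl -lee_fin fineK//.
have oVC : open (V `&` ~` C).
  by apply: openI => //; apply: closed_openC; exact: compact_closed.
apply: le_trans (outer_le oVC _) _.
  by apply: setIS; apply: subsetC => x /CVU[].
rewrite lee_fin; apply: inner_le => D cD DVC DK.
have CD : C `&` D = set0.
  by rewrite -subset0 => x [Cx /DVC[_]].
rewrite lerBrDl -m_add//; apply: le_inner; first exact: compactU.
- by rewrite subUset; split=> x; [move=> /CVU[]|move=> /DVC[]].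
- by rewrite subUset.
Qed.

Let outer_borel (A : set (borel X)) : measurable A -> outer.-caratheodory A.
Proof.
apply: (@smallest_sub _ (sigma_algebra setT)); last exact: outer_caratheodory.
exact: (@sigma_algebra_measurable _ (caratheodory_type outer)).
Qed.

(** The same set function, retyped on [borel X] so that it can carry a measure structure. *)
Let measure_of_outer : set (borel X) -> \bar R := outer_content.

Let mu0 : measure_of_outer set0 = 0%E. Proof. exact: outer0. Qed.

Let mu_ge0 A : (0 <= measure_of_outer A)%E. Proof. exact: outer_ge0. Qed.

Let mu_sigma_additive : semi_sigma_additive measure_of_outer.
Proof.
move=> A mA tA mbA.
apply: (@caratheodory_measure_sigma_additive _ X outer A) => //.
  by move=> i; exact: outer_borel.
exact: outer_borel.
Qed.

Lemma regular_probability : m K = 1 ->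
  exists mu : probability (borel X) R, mu (~` K) = 0%E /\
    forall C, compact C -> C `<=` K -> ((m C)%:E <= mu C)%E.
Proof.
move=> mK.
have mu1 : measure_of_outer setT = 1%E.
  rewrite /measure_of_outer outer_open; last exact: openT.
  congr EFin; apply/eqP; rewrite eq_le -mK le_inner// andbT.
  by apply: inner_le => C _ _ CK; exact: m_le.
pose mu : {measure set (borel X) -> \bar R} := HB.pack measure_of_outer
  (isMeasure.Build _ _ R measure_of_outer mu0 mu_ge0 mu_sigma_additive).
pose P : probability (borel X) R := HB.pack (mu : set (borel X) -> \bar R)
  (Measure.on mu) (Measure_isProbability.Build _ _ R mu mu1).
exists P; split.
  rewrite /P /= /measure_of_outer outer_open; last first.
    exact/closed_openC/(compact_closed hX cK).
  congr EFin; apply/eqP; rewrite eq_le inner_ge0 andbT; apply: inner_le => C cC CK' CK.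
  suff -> : C = set0 by rewrite m0.
  by rewrite -subset0 => x Cx; exact: CK' Cx (CK _ Cx).
move=> C cC CK; rewrite /P /=; apply: le_outer => U oU CU.
by rewrite lee_fin le_inner.
Qed.

End RegularExtension.

(** * The minimax functional *)

Section BoundedFunctions.
Context {R : realType} {T : Type} (K : set T).

(** Nothing is required off K, and no continuity on K, so that indicators of arbitrary sets belong
    to the space. *)
Definition bounded_on_pred : {pred T -> R} :=
  fun f => `[< exists M, forall x, K x -> `|f x| <= M >].

Record bounded_on := BoundedOn {
  bounded_on_fun :> T -> R ;
  bounded_onP : bounded_on_fun \in bounded_on_pred }.

HB.instance Definition _ := [isSub for bounded_on_fun].
HB.instance Definition _ := [Choice of bounded_on by <:].

Lemma bounded_on_submod_closed : submod_closed bounded_on_pred.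
Proof.
split=> [|a f g /asboolP[M fM] /asboolP[N gN]]; apply/asboolP.
  by exists 0 => x _; rewrite normr0.
exists (`|a| * M + N) => x Kx; rewrite (le_trans (ler_normD _ _))//.
by rewrite lerD ?gN// normrM ler_wpM2l// fM.
Qed.

HB.instance Definition _ := GRing.isSubmodClosed.Build R (T -> R)
  bounded_on_pred bounded_on_submod_closed.
HB.instance Definition _ := [SubChoice_isSubLmodule of bounded_on by <:].

Implicit Types f g : bounded_on.

Lemma bounded_on_intro (f : T -> R) M : (forall x, K x -> `|f x| <= M) ->
  exists g : bounded_on, g = f :> (T -> R).
Proof.
move=> fM; have fP : f \in bounded_on_pred by apply/asboolP; exists M.
by exists (BoundedOn fP).
Qed.

Lemma bounded_on_bound f : exists M, forall x, K x -> `|f x| <= M.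
Proof. by have /asboolP := bounded_onP f. Qed.

Lemma bounded_onD f g x : (f + g) x = f x + g x. Proof. by []. Qed.

Lemma bounded_onZ a f x : (a *: f) x = a * f x. Proof. by []. Qed.

Lemma bounded_onN f x : (- f) x = - f x. Proof. by []. Qed.

Lemma bounded_on_sum I (r : seq I) (F : I -> bounded_on) x :
  (\sum_(i <- r) F i) x = \sum_(i <- r) F i x.
Proof. by elim: r => [|i r ih]; rewrite ?big_nil // !big_cons bounded_onD ih. Qed.

End BoundedFunctions.
Arguments bounded_on R {T} K.

Section MinimaxFunctional.
Context {R : realType} {T : Type} {K : set T}.
Variables (I : Type) (L : I -> bounded_on R K).
Hypothesis K0 : K !=set0.
Hypothesis I0 : inhabited I.
Hypothesis LD : forall i j, exists k, forall x, K x -> L k x = L i x + L j x.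
Hypothesis LZ : forall a i, exists k, forall x, K x -> L k x = a * L i x.
Hypothesis Lge0 : forall i, exists2 x, K x & 0 <= L i x.

Implicit Types f g : bounded_on R K.

Definition sup_on f : R := sup [set f x | x in K].

Lemma le_sup_on f x : K x -> f x <= sup_on f.
Proof.
move=> Kx; have [M fM] := bounded_on_bound f.
apply: ub_le_sup; last by exists x.
by exists M => _ [y Ky <-]; rewrite (le_trans (ler_norm _))// fM.
Qed.

Lemma sup_on_le f M : (forall x, K x -> f x <= M) -> sup_on f <= M.
Proof.
move=> fM; have [x Kx] := K0; apply: ge_sup; first by exists (f x), x.
by move=> _ [y Ky <-]; exact: fM.
Qed.

Definition minimax f : R := inf [set sup_on (f + L i) | i in [set: I]].

(** If |f| <= M on K, a point where [L i] is nonnegative shows that every supremum is at least -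
    M. *)
Lemma minimax_has_inf f : has_inf [set sup_on (f + L i) | i in [set: I]].
Proof.
case: I0 => i0; split; first by exists (sup_on (f + L i0)), i0.
have [M fM] := bounded_on_bound f.
exists (- M) => _ [i _ <-]; have [x Kx Lx] := Lge0 i.
apply: le_trans (le_sup_on _ Kx); rewrite bounded_onD.
by have := fM _ Kx; rewrite ler_norml => /andP[+ _]; lra.
Qed.

Lemma minimax_le f i M : (forall x, K x -> f x + L i x <= M) -> minimax f <= M.
Proof.
move=> h; apply: (@le_trans _ _ (sup_on (f + L i))); last exact: sup_on_le.
by apply: ge_inf; [exact: (minimax_has_inf f).2|exists i].
Qed.

Lemma le_minimax f M : (forall i, M <= sup_on (f + L i)) -> M <= minimax f.
Proof.
move=> h; apply: lb_le_inf; first exact: (minimax_has_inf f).1.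
by move=> _ [i _ <-].
Qed.

(** Near-optimal indices i for f and j for g are merged into k with [L k] = [L i] + [L j] on K.
    Scaling by t > 0 rescales the index likewise, and t = 0 uses an index with [L k] = 0 on K. *)
Lemma minimax_sublinear : sublinear minimax.
Proof.
split=> [f g|t f].
  rewrite -lerBlDr; apply: le_minimax => i.
  rewrite lerBlDr -lerBlDl; apply: le_minimax => j.
  rewrite lerBlDl; have [k LkE] := LD i j.
  apply: (minimax_le (i := k)) => x Kx; rewrite LkE// bounded_onD addrACA.
  by apply: lerD; rewrite -bounded_onD le_sup_on.
rewrite le_eqVlt => /predU1P[<-|t0].
  case: I0 => i0; have [k LkE] := LZ 0 i0.
  rewrite scale0r mul0r; apply: (minimax_le (i := k)) => x Kx.
  by rewrite LkE// mul0r addr0.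
rewrite mulrC -ler_pdivrMr//; apply: le_minimax => i; rewrite ler_pdivrMr// mulrC.
have [k LkE] := LZ t i.
apply: (minimax_le (i := k)) => x Kx.
rewrite LkE// bounded_onZ -mulrDr ler_pM2l//.
by rewrite -bounded_onD le_sup_on.
Qed.

(** The bound by M comes from an index that vanishes on K. For the kernel, the index of - a * [L i]
    cancels a *: [L i], so l (a *: [L i]) <= 0 for every real a, in particular for a = 1 and a =
    -1. *)
Lemma minimax_functional f0 : exists l : {scalar (bounded_on R K)},
  [/\ forall f M, (forall x, K x -> f x <= M) -> l f <= M,
      forall i, l (L i) = 0 & l f0 = minimax f0].
Proof.
have [l lp l0] := hahn_banach f0 minimax_sublinear.
exists l; split=> // [f M fM|i].
  case: I0 => i0; have [k LkE] := LZ 0 i0.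
  apply: le_trans (lp f) _; apply: (minimax_le (i := k)) => x Kx.
  by rewrite LkE// mul0r addr0 fM.
have L_le0 a : a * l (L i) <= 0.
  have [k LkE] := LZ (- a) i.
  rewrite -[a * _]linearZ; apply: le_trans (lp _) _.
  apply: (minimax_le (i := k)) => x Kx.
  by rewrite LkE// bounded_onZ mulNr subrr.
have := L_le0 1; have := L_le0 (-1); lra.
Qed.

End MinimaxFunctional.

(** * Riesz representation on compact sets *)

Section WithinContinuous.
Context {X : topologicalType} {K : set X}.
Hypotheses (hX : hausdorff_space X) (cK : compact K).

Lemma within_continuous_compact_preimage (Y : topologicalType) (f : X -> Y)
    (B : set Y) : {within K, continuous f} -> closed B -> compact (K `&` f @^-1` B).
Proof.
move=> /continuous_closedP fK cB; have /closed_subspaceP[V cV VK] := fK B cB.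
by rewrite setIC -VK setIC; exact: compact_closedI.
Qed.

End WithinContinuous.

Lemma open_borel (X : ptopologicalType) (A : set X) :
  open A -> measurable (A : set (borel X)).
Proof. exact: sub_sigma_algebra. Qed.

Lemma closed_borel (X : ptopologicalType) (A : set X) :
  closed A -> measurable (A : set (borel X)).
Proof.
move=> cA; rewrite -[A]setCK; apply: measurableC; apply: open_borel.
exact: closed_openC.
Qed.

Section IntegralOnCompact.
Context {R : realType} {X : ptopologicalType} {K : set X}.
Hypotheses (hX : hausdorff_space X) (cK : compact K).

Lemma compact_borel (A : set X) : compact A -> measurable (A : set (borel X)).
Proof. by move=> cA; apply: closed_borel; exact: compact_closed. Qed.

Lemma within_continuous_measurable (f : X -> R) : {within K, continuous f} ->
  measurable_fun (K : set (borel X)) (f : borel X -> R).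
Proof.
move=> fK; apply: (measurability _ (RGenCInfty.measurableE R)) => _ [_ [x ->] <-].
apply: compact_borel; apply: within_continuous_compact_preimage => //.
by rewrite set_itvE; exact: closed_ge.
Qed.

Lemma within_continuous_bounded (f : X -> R) : {within K, continuous f} ->
  exists M, forall x, K x -> `|f x| <= M.
Proof.
move=> fK; have /compact_bounded[M [_ MB]] := continuous_compact fK cK.
exists (M + 1) => x Kx; apply: (MB (M + 1)); first by rewrite ltrDl.
by exists x.
Qed.

Lemma within_continuous_integrable (mu : probability (borel X) R) (f : X -> R) :
  {within K, continuous f} -> mu.-integrable (K : set (borel X)) (EFin \o f).
Proof.
move=> fK; apply: measurable_bounded_integrable.
- exact: compact_borel.
- by rewrite (le_lt_trans (probability_le1 _ _))// ?ltry//; exact: compact_borel.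
- exact: within_continuous_measurable.
- have [M fM] := within_continuous_bounded fK.
  exists M; split; first exact: num_real.
  by move=> N MN x Kx /=; exact: le_trans (fM _ Kx) (ltW MN).
Qed.

End IntegralOnCompact.

(** The sum is e times the smaller of n and the integer part of y / e. Thresholds start at e, not at
    0, which keeps the staircase below y. *)
Lemma staircase_bounds (R : realType) (e y : R) n : 0 < e -> 0 <= y ->
  let s := \sum_(k < n) e * (k.+1%:R * e <= y)%R%:R in
  s <= y /\ (y <= n%:R * e -> y <= s + e).
Proof.
move=> e0 y0 s.
(* The induction needs the exact value n * e once y has passed all n thresholds. *)
suff : [/\ s <= y, y < n%:R * e -> y <= s + e & n%:R * e <= y -> s = n%:R * e].
  move=> [sy lt_s eq_s]; split=> // yn; have [/lt_s//|ny] := ltP y (n%:R * e).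
  by rewrite eq_s// (le_trans yn)// lerDl ltW.
rewrite {}/s; elim: n => [|n [sy lt_s eq_s]].
  by rewrite big_ord0 mul0r; split=> //; rewrite ltNge y0.
have nS : n.+1%:R * e = n%:R * e + e by rewrite -natr1 mulrDl mul1r.
rewrite big_ord_recr /=; have [ny|yn] := leP (n.+1%:R * e) y.
  rewrite mulr1 eq_s; last by rewrite (le_trans _ ny)// nS lerDl ltW.
  by rewrite -nS; split=> //; rewrite ltNge ny.
rewrite mulr0 addr0; split=> // _; have [/lt_s//|ny] := ltP y (n%:R * e).
by rewrite eq_s// -nS ltW.
Qed.

Section RieszCompact.
Context {R : realType} {X : ptopologicalType} {K : set X}.
Hypotheses (hX : hausdorff_space X) (cK : compact K).
Variable l : {scalar (bounded_on R K)}.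
Hypothesis l_le : forall (f : bounded_on R K) M,
  (forall x, K x -> f x <= M) -> l f <= M.

Fact indicator_bounded (A : set X) : \1_A \in @bounded_on_pred R X K.
Proof.
apply/asboolP; exists 1 => x _; rewrite indicE.
by case: (x \in A); rewrite ?normr1 ?normr0.
Qed.

Definition indicator A : bounded_on R K := BoundedOn (indicator_bounded A).

Let m A := l (indicator A).

Let l_mono (f g : bounded_on R K) : (forall x, K x -> f x <= g x) -> l f <= l g.
Proof.
move=> fg; rewrite -subr_le0 -linearB; apply: l_le => x Kx.
by rewrite bounded_onD bounded_onN subr_le0 fg.
Qed.

Let m_ge0 A : 0 <= m A.
Proof. by rewrite -(linear0 l); apply: l_mono => x _ /=; rewrite indicE. Qed.

Let m_add A B : A `&` B = set0 -> m (A `|` B) = m A + m B.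
Proof.
move=> AB; rewrite /m -linearD; congr (l _); apply/val_inj/funext => x.
rewrite /= fctE !indicE in_setU.
have [xA|] := boolP (x \in A); last by rewrite add0r.
have [xB|] := boolP (x \in B); last by rewrite addr0.
by have : x \in A `&` B by [rewrite in_setI xA]; rewrite AB inE.
Qed.

Let l1 : l (indicator setT) = 1.
Proof.
apply/eqP; rewrite eq_le; apply/andP; split.
  by apply: l_le => x _ /=; rewrite indicT.
rewrite -lerN2 -linearN; apply: l_le => x _.
by rewrite bounded_onN /= indicT.
Qed.

(** Layer-cake comparison: the superlevel sets [C k] of f in K are compact, so [m] <= mu on them,
    and the staircase built on their indicators lies within e below f on K. *)
Let l_le_integral (mu : probability (borel X) R) (f : bounded_on R K) :
  (forall C, compact C -> C `<=` K -> ((m C)%:E <= mu C)%E) ->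
  {within K, continuous f} -> (forall x, K x -> 0 <= f x) ->
  l f <= \int[mu]_(x in K) f x.
Proof.
move=> m_le_mu fK f0; apply/ler_addgt0Pl => e e0.
have mK : measurable (K : set (borel X)) by exact: compact_borel.
pose C k := K `&` f @^-1` [set y | k.+1%:R * e <= y].
have cC k : compact (C k).
  by apply: within_continuous_compact_preimage => //; exact: closed_ge.
have mC k : measurable (C k : set (borel X)) by exact: compact_borel.
pose stair n : bounded_on R K := \sum_(k < n) e *: indicator (C k).
have stairE n x : K x -> stair n x = \sum_(k < n) e * (k.+1%:R * e <= f x)%R%:R.
  move=> Kx; rewrite bounded_on_sum; apply: eq_bigr => k _.
  rewrite bounded_onZ /= indicE; congr (_ * (nat_of_bool _)%:R).
  by apply/idP/idP; rewrite inE; [case|split].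
have int_stair n : mu.-integrable (K : set (borel X)) (EFin \o stair n) /\
    \int[mu]_(x in K) stair n x = \sum_(k < n) e * fine (mu (C k)).
  have intC k : mu.-integrable (K : set (borel X)) (EFin \o (e *: indicator (C k))).
    have -> : EFin \o (e *: indicator (C k)) =
      (fun x => e%:E * (\1_(C k) x)%:E)%E by [].
    apply: integrableZl => //; apply: (integrableS measurableT) => //.
    exact: integrable_indic.
  elim: n => [|n [intn intnE]].
    rewrite /stair !big_ord0; split; first exact: integrable0.
    by rewrite Rintegral_cst// mul0r.
  have stairS x : stair n.+1 x = stair n x + (e *: indicator (C n)) x.
    by rewrite /stair big_ord_recr.
  have -> : EFin \o stair n.+1 =
      (fun x => (stair n x)%:E + ((e *: indicator (C n)) x)%:E)%E.
    by apply/funext => x /=; rewrite stairS.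
  split; first exact: (integrableD mK intn (intC n)).
  under eq_Rintegral do rewrite stairS.
  rewrite RintegralD// big_ord_recr [RHS]/= intnE; congr (_ + _).
  under eq_Rintegral do rewrite bounded_onZ.
  rewrite RintegralZl//=; last first.
    by apply: (integrableS measurableT) => //; exact: integrable_indic.
  rewrite /Rintegral integral_indic//; congr (_ * fine (mu _)).
  by rewrite setIidl//; exact: subIsetl.
have [M fM] := bounded_on_bound f.
(* Enough steps for the staircase to reach the bound M of f. *)
have [n nM] : exists n, M <= n%:R * e.
  exists (Num.truncn (M / e)).+1; rewrite -ler_pdivrMr// ltW//.
  exact: truncnS_gt.
have [intn intnE] := int_stair n.
have fle x : K x -> f x <= (stair n + e *: indicator setT) x.
  move=> Kx; rewrite bounded_onD bounded_onZ /= indicT /= mulr1 stairE//.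
  apply: (staircase_bounds n e0 (f0 x Kx)).2; apply: le_trans nM.
  exact: le_trans (ler_norm _) (fM x Kx).
rewrite (le_trans (l_mono fle))// linearD linearZ /= l1 mulr1 addrC lerD2l.
apply: (@le_trans _ _ (\int[mu]_(x in K) stair n x)).
  rewrite intnE linear_sum; apply: ler_sum => k _; rewrite linearZ /=.
  rewrite ler_pM2l// -lee_fin fineK ?m_le_mu//; first exact: subIsetl.
  exact: fin_num_measure.
apply: le_Rintegral => //; first exact: within_continuous_integrable.
by move=> x Kx; rewrite stairE//; exact: (staircase_bounds n e0 (f0 x Kx)).1.
Qed.

(** The one-sided comparison suffices: applied to both f and - f, it gives equality. *)
Lemma riesz_compact : exists mu : probability (borel X) R, mu (~` K) = 0%E /\
  forall f : bounded_on R K, {within K, continuous f} -> \int[mu]_(x in K) f x = l f.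
Proof.
have mK1 : m K = 1.
  rewrite -l1 /m; apply/eqP; rewrite eq_le; apply/andP; split;
    by apply: l_mono => x Kx /=; rewrite !indicE !mem_set.
have [mu [muK m_le_mu]] := regular_probability hX cK m_ge0 m_add mK1.
exists mu; split=> // f fK.
have mK : measurable (K : set (borel X)) by exact: compact_borel.
have muK1 : mu K = 1%E.
  by rewrite -[K]setCK probability_setC ?muK ?sube0//; exact: measurableC.
suff le_int (g : bounded_on R K) : {within K, continuous g} ->
    l g <= \int[mu]_(x in K) g x.
  apply/eqP; rewrite eq_le le_int// andbT -lerN2 -linearN.
  apply: le_trans (le_int (- f) _) _.
    by move=> x; apply: cvgN; exact: fK.
  under eq_Rintegral do rewrite bounded_onN -mulN1r.
  by rewrite RintegralZl//; [rewrite mulN1r|exact: within_continuous_integrable].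
move=> gK; have [M gM] := bounded_on_bound g.
(* Adding the bound M makes g nonnegative on K; l and the integral both grow by exactly M, since l
   (1) = 1 and mu K = 1. *)
pose h : bounded_on R K := g + M *: indicator setT.
have hE x : h x = g x + M by rewrite bounded_onD bounded_onZ /= indicT mulr1.
have hK : {within K, continuous h}.
  rewrite (_ : (h : X -> R) = (fun x => g x + M)); last by apply/funext => x; exact: hE.
  by move=> x; apply: cvgD; [exact: gK|exact: cvg_cst].
have h0 x : K x -> 0 <= h x.
  by move=> Kx; rewrite hE; have := gM _ Kx; rewrite ler_norml => /andP[+ _]; lra.
have int_h : \int[mu]_(x in K) h x = \int[mu]_(x in K) g x + M.
  under eq_Rintegral do rewrite hE.
  rewrite RintegralD//.
  - rewrite Rintegral_cst//; congr (_ + _).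
    by have /(congr1 fine) /= -> := muK1; rewrite mulr1.
  - exact: within_continuous_integrable.
  - by apply: within_continuous_integrable => // x; exact: cvg_cst.
have := l_le_integral m_le_mu hK h0; rewrite int_h.
by rewrite linearD linearZ /= l1 mulr1 lerD2r.
Qed.

End RieszCompact.

(** * Continuously differentiable functions and cutoffs *)

Section ContinuouslyDifferentiable.
Context {R : realType}.

(* In finite dimension, continuity of every directional differential is that
   of x |-> 'd f x. *)
Definition C1 (V : normedModType R) (f : V -> R) : Prop :=
  (forall x, differentiable f x) /\ forall v, continuous (fun x => 'd f x v).

Section Closure.
Context {V : normedModType R}.
Implicit Types f g : V -> R.

Lemma C1_continuous f : C1 f -> continuous f.
Proof. by move=> [df _] x; exact: differentiable_continuous. Qed.

Lemma C1_cst (a : R) : C1 (cst a : V -> R).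
Proof.
split=> [x|v]; first exact: differentiable_cst.
rewrite (_ : (fun _ => _) = cst 0); first by move=> x; exact: cvg_cst.
by apply/funext => x; rewrite diff_cst.
Qed.

Lemma diff_add f g x v : differentiable f x -> differentiable g x ->
  'd (fun y => f y + g y) x v = 'd f x v + 'd g x v.
Proof. by move=> df dg; exact: (congr1 (fun h => h v) (diffD df dg)). Qed.

Lemma diff_mul f g x v : differentiable f x -> differentiable g x ->
  'd (fun y => f y * g y) x v = f x * 'd g x v + g x * 'd f x v.
Proof. by move=> df dg; exact: (congr1 (fun h => h v) (diffM df dg)). Qed.

Lemma C1D f g : C1 f -> C1 g -> C1 (fun x => f x + g x).
Proof.
move=> [df cf] [dg cg]; split=> [x|v]; first exact: differentiableD.
have -> : (fun x => 'd (fun y => f y + g y) x v) = (fun x => 'd f x v + 'd g x v).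
  by apply/funext => x; exact: diff_add.
by move=> x; exact: (cvgD (cf v x) (cg v x)).
Qed.

Lemma C1M f g : C1 f -> C1 g -> C1 (fun x => f x * g x).
Proof.
move=> C1f C1g; have [df cf] := C1f; have [dg cg] := C1g.
split=> [x|v]; first exact: differentiableM.
have -> : (fun x => 'd (fun y => f y * g y) x v) =
    (fun x => f x * 'd g x v + g x * 'd f x v).
  by apply/funext => x; exact: diff_mul.
have cfx := C1_continuous C1f; have cgx := C1_continuous C1g.
move=> x; exact: (cvgD (cvgM (cfx x) (cg v x)) (cvgM (cgx x) (cf v x))).
Qed.

Lemma C1_sum n (f : 'I_n -> V -> R) : (forall i, C1 (f i)) ->
  C1 (fun x => \sum_i f i x).
Proof.
move=> C1f; elim: n f C1f => [|n ih] f C1f.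
  rewrite (_ : (fun _ => _) = cst 0); first exact: C1_cst.
  by apply/funext => x; rewrite big_ord0.
rewrite (_ : (fun _ => _) = (fun x => f ord0 x + \sum_i f (lift ord0 i) x)).
  exact: (C1D (C1f ord0) (ih (fun i => f (lift ord0 i)) (fun i => C1f (lift ord0 i)))).
by apply/funext => x; rewrite big_ord_recl.
Qed.

Lemma diff_scale (a : R) f x v : differentiable f x ->
  'd (fun y => a * f y) x v = a * 'd f x v.
Proof. by move=> df; exact: (congr1 (fun h => h v) (diffZ a df)). Qed.

Lemma diff_comp_linear (U : normedModType R) (L : {linear U -> V}) f x v :
  continuous L -> differentiable f (L x) ->
  'd (fun y => f (L y)) x v = 'd f (L x) (L v).
Proof.
move=> cL df; have dL : differentiable L x by exact: linear_differentiable.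
by rewrite (diff_comp dL df) /= diff_lin.
Qed.

Lemma C1_comp_linear (U : normedModType R) (L : {linear U -> V}) f :
  continuous L -> C1 f -> C1 (fun y => f (L y)).
Proof.
move=> cL [df cf]; have dL x : differentiable L x by exact: linear_differentiable.
split=> [x|v]; first exact: differentiable_comp.
have -> : (fun x => 'd (fun y => f (L y)) x v) = (fun x => 'd f (L x) (L v)).
  by apply/funext => x; exact: diff_comp_linear.
by move=> x; apply: (@continuous_comp _ _ _ L (fun y => 'd f y (L v)));
  [exact: cL|exact: cf].
Qed.

Lemma diff_cst_sub (a : R) f x v : differentiable f x ->
  'd (fun y => a - f y) x v = - 'd f x v.
Proof.
move=> df; transitivity ('d (cst a : V -> R) x v - 'd f x v).
  exact: (congr1 (fun g => g v) (diffB (differentiable_cst a x) df)).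
by have := congr1 (fun g => g v) (@diff_cst _ V R a x) => /= ->; rewrite sub0r.
Qed.

Lemma diff_comp_real (h : R -> R) f x v : differentiable h (f x) ->
  differentiable f x -> 'd (fun y => h (f y)) x v = 'd f x v * h^`()%classic (f x).
Proof. by move=> dh df; rewrite (diff_comp df dh) /= diff1E. Qed.

Lemma C1_comp (h : R -> R) f : (forall t, differentiable h t) ->
  continuous (h^`()%classic) -> C1 f -> C1 (fun x => h (f x)).
Proof.
move=> dh ch C1f; have [df cf] := C1f.
split=> [x|v]; first exact: differentiable_comp.
have -> : (fun x => 'd (fun y => h (f y)) x v) =
    (fun x => 'd f x v * h^`()%classic (f x)).
  by apply/funext => x; rewrite diff_comp_real.
move=> x; apply: (cvgM (cf v x)).
by apply: (@continuous_comp _ _ _ f); [exact: C1_continuous|exact: ch].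
Qed.

End Closure.

(** Squaring the positive part removes its corner at 0, leaving a C^1 function. *)
Definition sqr_pos (t : R) : R := Num.max 0 t ^+ 2.

Lemma sqr_pos_le0 t : t <= 0 -> sqr_pos t = 0.
Proof. by move=> t0; rewrite /sqr_pos max_l// expr0n. Qed.

Lemma is_derive_sqr_pos t : is_derive t (1 : R) sqr_pos (2 * Num.max 0 t).
Proof.
suff h : h^-1 *: (sqr_pos (h *: (1 : R) + t) - sqr_pos t) @[h --> 0^'] -->
    2 * Num.max 0 t.
  by apply: DeriveDef; [apply/cvg_ex; eexists; exact: h|exact: cvg_lim h].
apply/cvgrPdist_le => e e0; near=> s.
have s0 : s != 0 by near: s; exact: nbhs_dnbhs_neq.
have se : `|s| <= e.
  near: s; apply: dnbhs0_le => //.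
rewrite -(ler_pM2l (x := `|s|)) ?normr_gt0//.
(* After multiplication by |s| it remains to bound the Taylor remainder of [sqr_pos] at t by s ^+ 2,
   which is checked on the signs of t and s + t. *)
apply: le_trans (_ : `|s| * `|s| <= _); last by rewrite ler_pM2l ?normr_gt0.
have -> : s^-1 *: (sqr_pos (s *: (1 : R) + t) - sqr_pos t) =
    s^-1 * (sqr_pos (s + t) - sqr_pos t) by rewrite [s *: _]mulr1.
rewrite -!normrM -expr2 mulrBr mulVKf//.
rewrite [X in _ <= X]ger0_norm ?sqr_ge0// ler_norml /sqr_pos.
have [t0|t0] := leP 0 t; have [st0|st0] := leP 0 (s + t); apply/andP; split; nra.
Unshelve. all: by end_near. Qed.

Lemma differentiable_sqr_pos t : differentiable sqr_pos t.
Proof. by apply/derivable1_diffP; case: (is_derive_sqr_pos t). Qed.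

Lemma derive1_sqr_pos t : sqr_pos^`()%classic t = 2 * Num.max 0 t.
Proof. by rewrite derive1E; exact: (derive_val (is_derive := is_derive_sqr_pos t)). Qed.

Lemma continuous_derive1_sqr_pos : continuous (sqr_pos^`()%classic).
Proof.
rewrite (_ : sqr_pos^`()%classic = fun t => 2 * Num.max 0 t).
  move=> t; apply: cvgM; first exact: cvg_cst.
  by apply: continuous_max; [exact: cvg_cst|exact: cvg_id].
by apply/funext => t; exact: derive1_sqr_pos.
Qed.

Lemma C1_sqr_pos (V : normedModType R) (f : V -> R) :
  C1 f -> C1 (fun x => sqr_pos (f x)).
Proof.
apply: C1_comp; [exact: differentiable_sqr_pos|exact: continuous_derive1_sqr_pos].
Qed.

(** * C^1 cutoffs with compact support on R^m *)

Section Cutoff.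
Context {m : nat}.
Implicit Types (x v : 'rV[R]_m).

(** The Euclidean square, a polynomial, is used instead of the max norm of ['rV[R]_m]. *)
Definition sqr_sum x : R := \sum_j x 0 j ^+ 2.

Definition coord_lin (j : 'I_m) (x : 'rV[R]_m) : R := x 0 j.

Lemma coord_linP j : linear (coord_lin j).
Proof. by move=> a x y; rewrite /coord_lin !mxE. Qed.

HB.instance Definition _ j :=
  GRing.isLinear.Build R 'rV[R]_m R *:%R (coord_lin j) (@coord_linP j).

Lemma C1_coord j : C1 (coord_lin j).
Proof.
have cl : continuous (coord_lin j) by exact: coord_continuous.
split=> [x|v]; first exact: linear_differentiable.
rewrite (_ : (fun x => 'd (coord_lin j) x v) = cst (coord_lin j v)).
  exact: cst_continuous.
by apply/funext => x; rewrite diff_lin.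
Qed.

Lemma C1_sqr_sum : C1 sqr_sum.
Proof. by apply: C1_sum => j; apply: (C1M (C1_coord j) (C1_coord j)). Qed.

(** The inner [sqr_pos] is 0 while [sqr_sum x] <= M and at least 1 from M + 1 on; the outer one
    turns this into 1 and 0. *)
Definition cutoff (M : R) x : R := sqr_pos (1 - sqr_pos (sqr_sum x - M)).

Let C1_outer M : C1 (fun x => sqr_pos (sqr_sum x - M)).
Proof. by apply: C1_sqr_pos; apply: (C1D C1_sqr_sum (C1_cst (- M))). Qed.

Let C1_inner M : C1 (fun x => 1 - sqr_pos (sqr_sum x - M)).
Proof.
rewrite (_ : (fun _ => _) = (fun x => 1 + (-1) * sqr_pos (sqr_sum x - M))).
  exact: (C1D (C1_cst 1) (C1M (C1_cst (-1)) (C1_outer M))).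
by apply/funext => x; rewrite mulN1r.
Qed.

Lemma C1_cutoff M : C1 (cutoff M).
Proof. exact: (C1_sqr_pos (C1_inner M)). Qed.

Lemma cutoff_in M x : sqr_sum x <= M -> cutoff M x = 1.
Proof.
move=> xM; rewrite /cutoff (sqr_pos_le0 (t := sqr_sum x - M)) ?subr_le0//.
by rewrite subr0 /sqr_pos max_r// expr1n.
Qed.

Lemma cutoff_out M x : M + 1 <= sqr_sum x -> cutoff M x = 0.
Proof.
by move=> xM; apply: sqr_pos_le0; rewrite subr_le0 /sqr_pos max_r; nra.
Qed.

(** The boundary [sqr_sum x] = M is included, where the cutoff need not be locally constant; the
    chain rule still gives 0, since the derivative of [sqr_pos] vanishes on t <= 0. *)
Lemma diff_cutoff_in M x v : sqr_sum x <= M -> 'd (cutoff M) x v = 0.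
Proof.
move=> xM.
have d_out : 'd (fun y => sqr_pos (sqr_sum y - M)) x v = 0.
  rewrite (diff_comp_real (f := fun y => sqr_sum y - M)).
  - by rewrite derive1_sqr_pos max_l ?mulr0// subr_le0.
  - exact: differentiable_sqr_pos.
  - exact: (C1D C1_sqr_sum (C1_cst (- M))).1.
rewrite (diff_comp_real (f := fun y => 1 - sqr_pos (sqr_sum y - M))).
- suff -> : 'd (fun y => 1 - sqr_pos (sqr_sum y - M)) x v = 0 by rewrite mul0r.
  by rewrite diff_cst_sub ?d_out ?oppr0//; exact: (C1_outer M).1.
- exact: differentiable_sqr_pos.
- exact: (C1_inner M).1.
Qed.

Lemma cutoff_compact_support M (f : 'rV[R]_m -> R) :
  compact (closure [set x | f x * cutoff M x != 0]).
Proof.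
(* On the support x_i ^ 2 <= M + 1, hence M + 1 >= 0 and |x_i| <= M + 2. *)
pose box := [set x : 'rV[R]_m | forall i, (x ord0 i) \in `[- (M + 2), M + 2]].
have cbox : compact box.
  apply: (@rV_compact _ _ (fun=> `[- (M + 2), M + 2]%classic)).
  by move=> _; exact: segment_compact.
apply: (subclosed_compact _ cbox); first exact: closed_closure.
have M1 : closed [set x | sqr_sum x <= M + 1].
  apply: (@preimage_closed _ _ sqr_sum [set t | t <= M + 1]); last exact: closed_le.
  by move=> x _; exact: (C1_continuous C1_sqr_sum).
apply: (@subset_trans _ [set x | sqr_sum x <= M + 1]).
  rewrite [X in _ `<=` X](iffLR (closure_id _) M1); apply: closureS => x /=.
  by apply: contraNT; rewrite -ltNge => /ltW/cutoff_out ->; rewrite mulr0.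
move=> x /= xM i; rewrite in_itv /=.
have : x ord0 i ^+ 2 <= sqr_sum x.
  rewrite /sqr_sum (bigD1 i)//= lerDl; apply: sumr_ge0 => j _; exact: sqr_ge0.
by move=> xi; apply/andP; split; nra.
Qed.

End Cutoff.
End ContinuouslyDifferentiable.

(** * Cylindrical test functionals *)

Lemma continuous_sum (R : realType) (T : topologicalType) n (F : 'I_n -> T -> R) :
  (forall i, continuous (F i)) -> continuous (fun x => \sum_i F i x).
Proof. by move=> cF; apply: continuous_big => //; exact: add_continuous. Qed.

Lemma continuous_row (R : realType) (T : topologicalType) m (g : T -> 'I_m -> R) :
  (forall j, continuous (g^~ j)) -> continuous (fun t => \row_j g t j : 'rV[R]_m).
Proof.
move=> cg t; apply/cvg_ballP => e e0.
have near_t : \forall s \near t, forall j, ball (g t j) e (g s j).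
  by apply: filter_forall => k; have /cvg_ballP := cg k t; exact.
by apply: filterS near_t => s ts; split=> // i j; rewrite !mxE.
Qed.

Lemma C1c_C1 (R : realType) m (psi : 'rV[R]_m -> R) : C1c psi -> C1 psi.
Proof.
move=> [dpsi cpsi _]; split=> // v.
have -> : (fun x => 'd psi x v) = (fun x => \sum_j v 0 j * partial psi j x).
  apply/funext => x; rewrite {1}[v]row_sum_delta linear_sum /=.
  by apply: eq_bigr => j _; rewrite linearZ /partial deriveE.
by apply: continuous_sum => j x; exact: (cvgM (cvg_cst _) (cpsi j x)).
Qed.

Section CylindricalOnCompact.
Context {R : realType} {W : normedModType R}.

Lemma pairing_cyl_deriv (Psi : cyl_test W) (u v : dual W) :
  pairing v (cyl_deriv Psi u) =
  'd (cyl_psi Psi) (cyl_coord Psi u) (cyl_coord Psi v).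
Proof.
have [dpsi _ _] := cyl_psi_C1c Psi.
rewrite [X in _ = _ X]row_sum_delta linear_sum /=.
rewrite /pairing /cyl_deriv linear_sum /=; apply: eq_bigr => j _.
by rewrite !linearZ /= !mxE /partial deriveE//; exact: mulrC.
Qed.

(** Multiply f by the cutoff. Where [sqr_sum] <= M the cutoff is 1 with zero differential, so the
    product rule leaves the differential of f unchanged. *)
Lemma cyl_test_of_C1 m (f : 'rV[R]_m -> R) (w : 'I_m -> W) (M : R) : C1 f ->
  exists Psi : cyl_test W, forall u v : dual W,
    sqr_sum (\row_j pairing u (w j)) <= M ->
    pairing v (cyl_deriv Psi u) =
    'd f (\row_j pairing u (w j)) (\row_j pairing v (w j)).
Proof.
move=> C1f; pose psi := fun x => f x * cutoff M x.
have C1psi : C1 psi by exact: (C1M C1f (C1_cutoff M)).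
have C1cpsi : C1c psi.
  split; [exact: C1psi.1|move=> j|exact: cutoff_compact_support].
  have -> : partial psi j = (fun x => 'd psi x (delta_mx 0 j)).
    by apply/funext => x; rewrite /partial deriveE//; exact: C1psi.1.
  exact: C1psi.2.
exists (CylTest w C1cpsi) => u v uM; rewrite pairing_cyl_deriv /=.
set x := \row_j _ in uM *; set y := \row_j _.
rewrite diff_mul//; [|exact: C1f.1|exact: (C1_cutoff M).1].
by rewrite diff_cutoff_in// cutoff_in// mulr0 add0r mul1r.
Qed.

Lemma pairing_continuous (w : W) : continuous (fun u : dual W => pairing u w).
Proof.
have lin : linear (fun u : dual W => pairing u w).
  by move=> a f g; rewrite /pairing dualD dualZ.
pose ev : {linear dual W -> R} := HB.pack (fun u : dual W => pairing u w)
  (GRing.isLinear.Build R (dual W) R *:%R _ lin).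
suff : continuous ev by [].
apply/bounded_linear_continuous/linear_boundedP.
exists `|w|; split=> [|M wM u]; first exact: num_real.
rewrite (le_trans (ler_dual_norm u w))// mulrC -dual_normE.
exact: (ler_wpM2r (normr_ge0 u) (ltW wM)).
Qed.

Lemma coords_continuous m (w : 'I_m -> W) :
  continuous (fun u : dual W => \row_j pairing u (w j) : 'rV[R]_m).
Proof. by apply: continuous_row => j; exact: pairing_continuous. Qed.

End CylindricalOnCompact.

Section TestValues.
Context {R : realType} {X : ptopologicalType} {W : normedModType R}.
Variables (incl F : X -> dual W) (K : set X).
Hypotheses (cK : compact K) (cincl : continuous incl).
Hypothesis cF : {within K, continuous F}.
Implicit Types Phi Psi : cyl_test W.

Definition test_value Psi (u : X) : R := pairing (F u) (cyl_deriv Psi (incl u)).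

Let coords_incl_continuous m (w : 'I_m -> W) :
  continuous (fun u => \row_j pairing (incl u) (w j) : 'rV[R]_m).
Proof.
move=> u; apply: (@continuous_comp _ _ _ incl
  (fun v : dual W => \row_j pairing v (w j) : 'rV[R]_m)); first exact: cincl.
exact: coords_continuous.
Qed.

Lemma test_value_continuous Psi : {within K, continuous (test_value Psi)}.
Proof.
have C1psi := C1c_C1 (cyl_psi_C1c Psi).
have -> : test_value Psi = (fun u => \sum_j
    partial (cyl_psi Psi) j (cyl_coord Psi (incl u)) * pairing (F u) (cyl_vec Psi j)).
  apply/funext => u; rewrite /test_value /pairing /cyl_deriv linear_sum /=.
  by apply: eq_bigr => j _; rewrite linearZ.
apply: (@continuous_sum R (subspace K)) => j.
have [_ cpartial _] := cyl_psi_C1c Psi.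
have c1 : continuous (fun u => partial (cyl_psi Psi) j (cyl_coord Psi (incl u))).
  move=> u; apply: (@continuous_comp _ _ _ (fun u => cyl_coord Psi (incl u))).
    exact: coords_incl_continuous.
  exact: cpartial.
have c2 : {within K, continuous (fun u => pairing (F u) (cyl_vec Psi j))}.
  move=> u; apply: (@continuous_comp (subspace K) _ _ F (fun f => pairing f _)).
    exact: cF.
  exact: pairing_continuous.
move=> u; have c1K := @continuous_subspaceT _ _ K _ c1.
by apply: cvgM; [exact: c1K|exact: c2].
Qed.

Lemma sqr_sum_coords_bounded m (w : 'I_m -> W) :
  exists M, forall u, K u -> sqr_sum (\row_j pairing (incl u) (w j)) <= M.
Proof.
have [|M KM] := @within_continuous_bounded R X K cK
    (fun u => sqr_sum (\row_j pairing (incl u) (w j))).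
  apply: continuous_subspaceT => u.
  apply: (@continuous_comp _ _ _ (fun u => \row_j pairing (incl u) (w j)) sqr_sum).
    exact: coords_incl_continuous.
  exact: (C1_continuous C1_sqr_sum).
by exists M => u /KM; exact: le_trans (ler_norm _).
Qed.

Lemma test_value_scale a Psi :
  exists Phi, forall u, K u -> test_value Phi u = a * test_value Psi u.
Proof.
have C1psi := C1c_C1 (cyl_psi_C1c Psi).
have [M KM] := sqr_sum_coords_bounded (cyl_vec Psi).
have [Phi PhiE] := cyl_test_of_C1 (cyl_vec Psi) M (C1M (C1_cst a) C1psi).
exists Phi => u /KM uM; rewrite /test_value PhiE// pairing_cyl_deriv.
exact: (diff_scale _ _ (C1psi.1 _)).
Qed.

(** With the two families of vectors concatenated, the sum is phi of the left block plus psi of the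
    right block. It need not have compact support on the product, so it is cut off outside a ball
    containing the coordinates of K. *)
Lemma test_value_add Phi Psi :
  exists Th, forall u, K u -> test_value Th u = test_value Phi u + test_value Psi u.
Proof.
have C1phi := C1c_C1 (cyl_psi_C1c Phi); have C1psi := C1c_C1 (cyl_psi_C1c Psi).
pose w (i : 'I_(cyl_dim Phi + cyl_dim Psi)) :=
  match fintype.split i with inl j => cyl_vec Phi j | inr j => cyl_vec Psi j end.
have [M KM] := sqr_sum_coords_bounded w.
have C1l := @C1_comp_linear _ _ _ lsubmx _
  (@continuous_lsubmx _ 1 _ (cyl_dim Psi)) C1phi.
have C1r := @C1_comp_linear _ _ _ rsubmx _
  (@continuous_rsubmx _ 1 (cyl_dim Phi) _) C1psi.
have [Th ThE] := cyl_test_of_C1 w M (C1D C1l C1r).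
exists Th => u /KM uM; rewrite /test_value ThE// !pairing_cyl_deriv.
have lE (v : dual W) : lsubmx (\row_j pairing v (w j)) = cyl_coord Phi v.
  by apply/rowP => j; rewrite !mxE /w; have /= -> := unsplitK (inl j).
have rE (v : dual W) : rsubmx (\row_j pairing v (w j)) = cyl_coord Psi v.
  by apply/rowP => j; rewrite !mxE /w; have /= -> := unsplitK (inr j).
rewrite (diff_add _ (C1l.1 _) (C1r.1 _)) -!lE -!rE.
congr (_ + _); apply: diff_comp_linear; try exact: C1phi.1; try exact: C1psi.1.
- exact: continuous_lsubmx.
- exact: continuous_rsubmx.
Qed.

End TestValues.

(** * Duality *)

Section CarriedProbability.
Context {R : realType} {X : ptopologicalType} {K : set X}.
Hypotheses (hX : hausdorff_space X) (cK : compact K).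
Variable mu : probability (borel X) R.
Hypothesis muK : mu (~` K) = 0%E.

Let mK : measurable (K : set (borel X)). Proof. exact: compact_borel. Qed.

Lemma carried_measure1 : mu K = 1%E.
Proof. by rewrite -[K]setCK probability_setC ?muK ?sube0//; exact: measurableC. Qed.

Lemma carried_nonempty : K !=set0.
Proof.
apply/set0P/eqP => K0; have := carried_measure1.
by rewrite K0 measure0 => /eqP; rewrite eq_sym onee_eq0.
Qed.

(** The complement of K is a null set, so integrability and the integral can be read on K, where g
    is bounded. *)
Lemma carried_integral (g : X -> R) : measurable_fun setT (g : borel X -> R) ->
  {within K, continuous g} ->
  mu.-integrable setT (EFin \o (g : borel X -> R)) /\
  \int[mu]_(u in setT) g u = \int[mu]_(u in K) g u.
Proof.
move=> mg gK; have intK := within_continuous_integrable hX cK mu gK.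
have mKC : measurable (~` K : set (borel X)) by exact: measurableC.
have TK : setT `\` ~` K = K by rewrite setTD setCK.
have intT : mu.-integrable setT (EFin \o (g : borel X -> R)).
  apply/(negligible_integrable mKC measurableT _ muK); last by rewrite TK.
  exact/measurable_EFinP.
split=> //; rewrite /Rintegral (negligible_integral mKC measurableT intT muK).
by rewrite TK.
Qed.

Lemma carried_integral_le (g : X -> R) M : {within K, continuous g} ->
  (forall x, K x -> g x <= M) -> \int[mu]_(u in K) g u <= M.
Proof.
move=> gK gM; apply: (@le_trans _ _ (\int[mu]_(u in K) M)).
  apply: le_Rintegral => //; first exact: within_continuous_integrable.
  by apply: within_continuous_integrable => // x; exact: cvg_cst.
rewrite Rintegral_cst//.
by have /(congr1 fine) /= -> := carried_measure1; rewrite mulr1.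
Qed.

End CarriedProbability.

Theorem theorem4p1 (R : realType) (X : ptopologicalType)
    (W : completeNormedModType R) (incl F : X -> dual W)
    (K : set X) (phi : X -> R)
    (X_hausdorff : hausdorff_space X)
    (incl_inj : injective incl) (incl_cont : continuous incl)
    (F_borel : measurable_fun [set: borel X] (F : borel X -> borel (dual W)))
    (K_compact : compact K) (K_metrizable : metrizable R (set_type K))
    (F_cont : {within K, continuous F})
    (wsss_neq0 : Pwsss incl F K !=set0)
    (phi_cont : {within K, continuous phi}) :
  let averages := [set \int[mu]_(u in K) phi u | mu in Pwsss incl F K] in
  let values (Psi : cyl_test W) :=
    [set phi u + pairing (F u) (cyl_deriv Psi (incl u)) | u in K] in
  let maxima := [set sup (values Psi) | Psi in [set: cyl_test W]] in
  [/\ has_max averages,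
      forall Psi, has_max (values Psi),
      has_inf maxima
    & sup averages = inf maxima].
Proof.
move=> averages values maxima.
have [mu0 [wmu0 mu0K]] := wsss_neq0.
have K0 := carried_nonempty X_hausdorff K_compact mu0K.
pose tv := test_value incl F.
have tv_cont Psi : {within K, continuous (tv Psi)} by exact: test_value_continuous.
(* Integrability against the given solution [mu0] includes Borel measurability, which does not
   depend on the measure and serves again for the Riesz measure. *)
have tv_meas Psi : measurable_fun setT (tv Psi : borel X -> R).
  by have [/integrableP[/measurable_EFinP]] := wmu0 Psi.
have tv_int mu Psi : Pwsss incl F K mu -> \int[mu]_(u in K) tv Psi u = 0.
  move=> [wmu muK].
  have [_ <-] :=
    carried_integral X_hausdorff K_compact muK (tv_meas Psi) (@tv_cont Psi).
  by have [] := wmu Psi.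
have /choice[L LE] : forall Psi, exists g : bounded_on R K, g = tv Psi :> (X -> R).
  move=> Psi.
  by have [M /bounded_on_intro] := within_continuous_bounded K_compact (@tv_cont Psi).
have [f fE] : exists g : bounded_on R K, g = phi :> (X -> R).
  by have [M /bounded_on_intro] := within_continuous_bounded K_compact phi_cont.
have LD Phi Psi : exists Th, forall x, K x -> L Th x = L Phi x + L Psi x.
  have [Th ThE] := test_value_add F K_compact incl_cont Phi Psi.
  by exists Th => x Kx; rewrite !LE; exact: ThE.
have LZ a Psi : exists Phi, forall x, K x -> L Phi x = a * L Psi x.
  have [Th ThE] := test_value_scale F K_compact incl_cont a Psi.
  by exists Th => x Kx; rewrite !LE; exact: ThE.
(* A test value has mean 0 under [mu0], which is carried by K, so its maximum over K is
   nonnegative. *)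
have Lge0 Psi : exists2 x, K x & 0 <= L Psi x.
  have [x /set_mem Kx xmax] := compact_EVT_max K0 K_compact (@tv_cont Psi).
  exists x => //; rewrite LE -(tv_int mu0 Psi)//.
  apply: (carried_integral_le X_hausdorff K_compact mu0K (@tv_cont Psi)) => y Ky.
  by apply: xmax; exact: mem_set.
(* The functional built from the zero function of no variables. *)
have I0 : inhabited (cyl_test W).
  have [Psi _] := cyl_test_of_C1 (fun _ : 'I_0 => (0 : W)) 0 (C1_cst (0 : R)).
  by constructor.
have sumE Psi x : (f + L Psi) x = phi x + tv Psi x by rewrite bounded_onD fE LE.
have maximaE : inf maxima = minimax L f.
  congr inf; apply: eq_imagel => Psi _; congr sup; apply: eq_imagel => u _.
  by rewrite sumE.
have sum_cont Psi : {within K, continuous (fun x => phi x + tv Psi x)}.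
  by move=> x; apply: cvgD; [exact: phi_cont|exact: tv_cont].
(* Weak duality: adding a test value does not change the mean under a stationary solution, and a
   mean is at most a supremum over K. *)
have avg_le mu : Pwsss incl F K mu -> \int[mu]_(u in K) phi u <= minimax L f.
  move=> wmu; have [_ muK] := wmu; apply: le_minimax => // Psi.
  have -> : \int[mu]_(u in K) phi u = \int[mu]_(u in K) (phi u + tv Psi u).
    rewrite RintegralD ?(tv_int mu Psi wmu) ?addr0//; first exact: compact_borel.
      exact: within_continuous_integrable.
    exact: within_continuous_integrable.
  apply: carried_integral_le => // x Kx.
  by rewrite -sumE le_sup_on.
have [l [l_le lL lf]] := minimax_functional K0 I0 LD LZ Lge0 f.
have [mu [muK mul]] := riesz_compact X_hausdorff K_compact l_le.
(* Stationarity is the vanishing of l on the test values, read through the Riesz representation. *)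
have wmu : Pwsss incl F K mu.
  split=> // Psi g.
  have [intg gE] :=
    carried_integral X_hausdorff K_compact muK (tv_meas Psi) (@tv_cont Psi).
  split=> //; rewrite gE -[RHS](lL Psi) -mul; last by rewrite LE; exact: tv_cont.
  by under [RHS]eq_Rintegral do rewrite LE.
have avg_mu : \int[mu]_(u in K) phi u = minimax L f.
  rewrite -lf -mul; last by rewrite fE.
  by under [RHS]eq_Rintegral do rewrite fE.
have avg_max : averages (minimax L f) by exists mu.
have avg_ub : ubound averages (minimax L f) by move=> _ [nu wnu <-]; exact: avg_le.
split.
- by exists (minimax L f).
- move=> Psi; have [x /set_mem Kx xmax] := compact_EVT_max K0 K_compact (@sum_cont Psi).
  exists (phi x + tv Psi x); first by exists x.
  by move=> _ [y Ky <-]; apply: xmax; exact: mem_set.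
- have := minimax_has_inf I0 Lge0 f; congr has_inf.
  apply: eq_imagel => Psi _; congr sup; apply: eq_imagel => u _.
  by rewrite sumE.
- rewrite maximaE; apply/eqP; rewrite eq_le; apply/andP; split.
    by apply: ge_sup => //; exists (minimax L f).
  by apply: ub_le_sup => //; exists (minimax L f).
Qed.
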